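(* Let $o\in\{1,\dots,n\}$. Then: (1) $\mathrm{DMU}_o$ is BCC inefficient (input orientation) if and only if there exists $(\mathbf{x},\mathbf{y})\in T^{DEA}$ with $(\mathbf{x},\mathbf{y})\succeq_I(\mathbf{x}_o,\mathbf{y}_o)$. (2) $\mathrm{DMU}_o$ is weakly BCC efficient (input orientation) if and only if there is no $(\mathbf{x},\mathbf{y})\in T^{DEA}$ with $(\mathbf{x},\mathbf{y})\succeq_I(\mathbf{x}_o,\mathbf{y}_o)$.
   Context: There are $n$ observed decision making units $\mathrm{DMU}_1,\dots,\mathrm{DMU}_n$; $\mathrm{DMU}_j$ has input vector $\mathbf{x}_j\in\mathbb{R}_+^m$ and output vector $\mathbf{y}_j\in\mathbb{R}_+^s$ (nonnegative entries). $\mathbf{X}=[\mathbf{x}_1\ \dots\ \mathbf{x}_n]$, $\mathbf{Y}=[\mathbf{y}_1\ \dots\ \mathbf{y}_n]$. For vectors, $\mathbf{u}\geqq\mathbf{v}$ means $u_j\ge v_j$ for all $j$. For nonnegative vectors, $\mathbf{u}>^+\mathbf{v}$ means that for every $j$ either $u_j>v_j$ or $u_j=v_j=0$. $\mathbf{1}_d,\mathbf{0}_d$ are the all-ones and all-zeros vectors in $\mathbb{R}^d$. Technology set: $T^{DEA}=\{(\mathbf{x},\mathbf{y})\in\mathbb{R}_+^m\times\mathbb{R}_+^s \mid \mathbf{x}\geqq\mathbf{X}\boldsymbol{\lambda},\ \mathbf{Y}\boldsymbol{\lambda}\geqq\mathbf{y},\ \mathbf{1}_n^T\boldsymbol{\lambda}=1,\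 \boldsymbol{\lambda}\geqq\mathbf{0}_n \text{ for some } \boldsymbol{\lambda}\in\mathbb{R}^n\}$. Input-oriented BCC model for $\mathrm{DMU}_o$: $\min\ \theta-\varepsilon(\mathbf{1}_m^T\mathbf{s}^-+\mathbf{1}_s^T\mathbf{s}^+)$ subject to $-\mathbf{X}\boldsymbol{\lambda}-\mathbf{s}^-\geqq-\theta\mathbf{x}_o$, $\mathbf{Y}\boldsymbol{\lambda}-\mathbf{s}^+\geqq\mathbf{y}_o$, $\mathbf{1}_n^T\boldsymbol{\lambda}=1$, $\boldsymbol{\lambda}\geqq\mathbf{0}_n$, $\mathbf{s}^-\geqq\mathbf{0}_m$, $\mathbf{s}^+\geqq\mathbf{0}_s$, with $\varepsilon>0$ a non-Archimedean infinitesimal; that is, first minimize $\theta$ (ignoring slacks) to get $\theta^*$, then fix $\theta=\theta^*$ and maximize the sum of the slacks. The following definition refers to an optimal solution of this model (whose existence is presupposed). With $\theta^*$ the optimal value of $\theta$: $\mathrm{DMU}_o$ is BCC inefficient iff $\theta^*<1$, and weakly BCC efficient iff $\theta^*=1$. FGL dominance (input orientation): for $(\mathbf{x}',\mathbf{y}'),(\mathbf{x},\mathbf{y})\in T^{DEA}$, $(\mathbf{x}',\mathbf{y}')\succeq_I(\mathbf{x},\mathbf{y})$ iff $\mathbf{x}>^+\mathbf{x}'$ and $\mathbf{y}'\geqq\mathbf{y}$. *)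

(* Defs.v *)
From HB Require Import structures.
From mathcomp Require Import all_boot all_order all_algebra.
From mathcomp Require Import reals.

Set Implicit Arguments.
Unset Strict Implicit.
Unset Printing Implicit Defensive.

Import Order.TTheory GRing.Theory Num.Theory.
Local Open Scope ring_scope.

Definition vec_ge (R : realType) (d : nat) (u v : 'cV[R]_d) : Prop :=
  forall j, v j 0 <= u j 0.

Definition vec_gt_plus (R : realType) (d : nat) (u v : 'cV[R]_d) : Prop :=
  forall j, v j 0 < u j 0 \/ (u j 0 = 0 /\ v j 0 = 0).

(* The j-th DMU is (col j X, col j Y). *)
Definition T_DEA (R : realType) (m s n : nat)
    (X : 'M[R]_(m, n)) (Y : 'M[R]_(s, n))
    (x : 'cV[R]_m) (y : 'cV[R]_s) : Prop :=
  vec_ge x 0 /\ vec_ge y 0 /\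
  exists lambda : 'cV[R]_n,
    [/\ vec_ge x (X *m lambda), vec_ge (Y *m lambda) y,
        \sum_j lambda j 0 = 1 & vec_ge lambda 0].

(* theta is unrestricted in sign. *)
Definition bcc_feasible (R : realType) (m s n : nat)
    (X : 'M[R]_(m, n)) (Y : 'M[R]_(s, n)) (o : 'I_n)
    (theta : R) (lambda : 'cV[R]_n) (sm : 'cV[R]_m) (sp : 'cV[R]_s) : Prop :=
  [/\ vec_ge (- (X *m lambda) - sm) (- (theta *: col o X)),
      vec_ge (Y *m lambda - sp) (col o Y) &
      [/\ \sum_j lambda j 0 = 1, vec_ge lambda 0, vec_ge sm 0 & vec_ge sp 0]].

Definition slack_sum (R : realType) (m s : nat)
    (sm : 'cV[R]_m) (sp : 'cV[R]_s) : R :=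
  \sum_i sm i 0 + \sum_r sp r 0.

(* The objective theta - eps * slack_sum with eps a non-Archimedean
   infinitesimal is read lexicographically: theta is minimized first, then
   slack_sum is maximized with theta fixed at its minimum. *)
Definition bcc_optimal (R : realType) (m s n : nat)
    (X : 'M[R]_(m, n)) (Y : 'M[R]_(s, n)) (o : 'I_n)
    (theta : R) (lambda : 'cV[R]_n) (sm : 'cV[R]_m) (sp : 'cV[R]_s) : Prop :=
  [/\ bcc_feasible X Y o theta lambda sm sp,
      forall theta' lambda' sm' sp',
        bcc_feasible X Y o theta' lambda' sm' sp' -> theta <= theta' &
      forall lambda' sm' sp',
        bcc_feasible X Y o theta lambda' sm' sp' ->
        slack_sum sm' sp' <= slack_sum sm sp].

Definition bcc_optimal_value (R : realType) (m s n : nat)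
    (X : 'M[R]_(m, n)) (Y : 'M[R]_(s, n)) (o : 'I_n) (theta : R) : Prop :=
  exists lambda sm sp, bcc_optimal X Y o theta lambda sm sp.

(* There is at most one optimal value, so the existential picks it out; without
   an optimal solution (e.g. if col o X = 0, where theta is unbounded below)
   neither of the next two notions applies. *)
Definition bcc_inefficient (R : realType) (m s n : nat)
    (X : 'M[R]_(m, n)) (Y : 'M[R]_(s, n)) (o : 'I_n) : Prop :=
  exists theta, bcc_optimal_value X Y o theta /\ theta < 1.

Definition weakly_bcc_efficient (R : realType) (m s n : nat)
    (X : 'M[R]_(m, n)) (Y : 'M[R]_(s, n)) (o : 'I_n) : Prop :=
  exists theta, bcc_optimal_value X Y o theta /\ theta = 1.

(* (x', y') dominates (x, y); membership in T_DEA is stated separately. *)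
Definition fgl_dominates_I (R : realType) (m s : nat)
    (x' : 'cV[R]_m) (y' : 'cV[R]_s) (x : 'cV[R]_m) (y : 'cV[R]_s) : Prop :=
  vec_gt_plus x x' /\ vec_ge y' y.

(* Main.v *)
(* For nonnegative x, the relation x_o >^+ x holds exactly when x lies below
   theta x_o for some theta < 1: take for theta the largest x_i / (x_o)_i, where
   the indices with (x_o)_i = x_i = 0 contribute 0 / 0 = 0. Hence dominance means
   that the BCC model has a feasible theta < 1, while theta = 1 is always
   feasible by choosing lambda as the o-th unit vector. *)

Require Import Defs.
From HB Require Import structures.
From mathcomp Require Import all_boot all_order all_algebra.
From mathcomp Require Import reals.

Set Implicit Arguments.
Unset Strict Implicit.
Unset Printing Implicit Defensive.

Import Order.TTheory GRing.Theory Num.Theory.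
Local Open Scope ring_scope.

(** Slacks do not enter the minimization of [theta], so producing feasible values of [theta] with
    zero slacks is enough. *)
Lemma feasible_contraction (R : realType) (m s n : nat)
    (X : 'M[R]_(m, n)) (Y : 'M[R]_(s, n)) (o : 'I_n) (theta : R)
    (lambda : 'cV[R]_n) :
  vec_ge (theta *: col o X) (X *m lambda) -> vec_ge (Y *m lambda) (col o Y) ->
  \sum_j lambda j 0 = 1 -> vec_ge lambda 0 ->
  bcc_feasible X Y o theta lambda 0 0.
Proof.
move=> hx hy h1 h0; split; rewrite ?subr0 //; last by split=> // i.
by move=> i; have := hx i; rewrite !mxE lerN2.
Qed.

Lemma feasible_one (R : realType) (m s n : nat)
    (X : 'M[R]_(m, n)) (Y : 'M[R]_(s, n)) (o : 'I_n) :
  bcc_feasible X Y o 1 (delta_mx o 0) 0 0.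
Proof.
(* By [colE], a matrix times the unit vector is its column [o], so both vector inequalities hold
   with equality. *)
apply: feasible_contraction; rewrite ?scale1r -?colE //.
- rewrite (bigD1 o) //= mxE !eqxx big1 ?addr0 // => j jo.
  by rewrite mxE (negPf jo).
- by move=> j; rewrite !mxE ler0n.
Qed.

Lemma gt_plus_contraction (R : realType) (m : nat) (x x' : 'cV[R]_m) :
  vec_ge x' 0 -> vec_gt_plus x x' ->
  exists2 theta, theta < 1 & vec_ge (theta *: x) x'.
Proof.
(* Starting the maximum at 0 is harmless since 0 < 1, and it covers m = 0. In the strict case
   [x' i 0 >= 0] forces [x i 0 > 0], so the ratio can be cleared. *)
move=> hx' hgt; exists (\big[Num.max/0]_i (x' i 0 / x i 0)).
  apply/bigmax_ltP; split=> // i _.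
  have := hx' i; rewrite mxE => x'0.
  case: (hgt i) => [lt|[-> ->]]; last by rewrite mul0r.
  by rewrite ltr_pdivrMr ?mul1r // (le_lt_trans x'0).
move=> i; have := hx' i; rewrite !mxE => x'0.
case: (hgt i) => [lt|[-> ->]]; last by rewrite mulr0.
rewrite -ler_pdivrMr ?(le_lt_trans x'0) //.
exact: (le_bigmax _ (fun i => x' i 0 / x i 0)).
Qed.

(** The weights [lambda] witnessing membership in the technology set are reused in the model: X
    lambda <= x <= theta x_o and Y lambda >= y >= y_o. *)
Lemma dominated_feasible (R : realType) (m s n : nat)
    (X : 'M[R]_(m, n)) (Y : 'M[R]_(s, n)) (o : 'I_n)
    (x : 'cV[R]_m) (y : 'cV[R]_s) :
  T_DEA X Y x y -> fgl_dominates_I x y (col o X) (col o Y) ->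
  exists theta lambda, theta < 1 /\ bcc_feasible X Y o theta lambda 0 0.
Proof.
move=> [x0 [_ [lambda [hx hy h1 h0]]]] [hgt hge].
have [theta lt1 hth] := gt_plus_contraction x0 hgt.
exists theta, lambda; split=> //; apply: feasible_contraction => //.
- by move=> i; apply: le_trans (hx i) (hth i).
- by move=> r; apply: le_trans (hge r) (hy r).
Qed.

Lemma mulmx_vec_ge0 (R : realType) (m n : nat) (A : 'M[R]_(m, n))
    (v : 'cV[R]_n) :
  (forall i j, 0 <= A i j) -> vec_ge v 0 -> vec_ge (A *m v) 0.
Proof.
move=> hA hv i; rewrite !mxE; apply: sumr_ge0 => j _.
by apply: mulr_ge0 => //; have := hv j; rewrite mxE.
Qed.

Lemma feasible_dominated (R : realType) (m s n : nat)
    (X : 'M[R]_(m, n)) (Y : 'M[R]_(s, n)) (o : 'I_n)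
    (theta : R) (lambda : 'cV[R]_n) (sm : 'cV[R]_m) (sp : 'cV[R]_s) :
  (forall i j, 0 <= X i j) -> (forall r j, 0 <= Y r j) ->
  bcc_feasible X Y o theta lambda sm sp -> theta < 1 ->
  T_DEA X Y (X *m lambda) (Y *m lambda) /\
  fgl_dominates_I (X *m lambda) (Y *m lambda) (col o X) (col o Y).
Proof.
move=> hX hY [hx hy [h1 h0 hm hp]] lt1.
have X0 := mulmx_vec_ge0 hX h0; have Y0 := mulmx_vec_ge0 hY h0.
split; first by do 2!split=> //; exists lambda; split=> // i.
split=> [i|r]; last first.
  (* Dropping the nonnegative slack weakens the constraint to Y lambda >= y_o; abstracting the
     product as [Z] keeps [mxE] from expanding it. *)
  have := hy r; have := hp r; move: (Y *m lambda) => Z.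
  by rewrite !mxE => p0 /le_trans -> //; rewrite gerBl.
have le_th : (X *m lambda) i 0 <= theta * X i o.
  have := hx i; have := hm i; move: (X *m lambda) => Z.
  by rewrite !mxE -opprD lerN2 => s0; apply: le_trans; rewrite lerDl.
rewrite [col o X i 0]mxE.
(* A positive input shrinks strictly because [theta < 1], whatever the sign of [theta]; a zero input
   squeezes the new one between 0 and theta times 0. *)
have [Xp|Xn] := ltP 0 (X i o).
  by left; apply: le_lt_trans le_th _; rewrite gtr_pMl.
have Xz : X i o = 0 by apply/eqP; rewrite eq_le Xn hX.
right; split=> //; apply/eqP; rewrite eq_le.
have := X0 i; rewrite [(0 : 'cV[R]_m) i 0]mxE => ->.
by rewrite Xz mulr0 in le_th; rewrite le_th.
Qed.

Theorem lemma3p1 (R : realType) (m s n : nat)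
    (X : 'M[R]_(m, n)) (Y : 'M[R]_(s, n))
    (hX : forall i j, 0 <= X i j) (hY : forall r j, 0 <= Y r j)
    (o : 'I_n)
    (hopt : exists theta, bcc_optimal_value X Y o theta) :
  (bcc_inefficient X Y o <->
     exists x y, T_DEA X Y x y /\ fgl_dominates_I x y (col o X) (col o Y)) /\
  (weakly_bcc_efficient X Y o <->
     ~ exists x y, T_DEA X Y x y /\ fgl_dominates_I x y (col o X) (col o Y)).
Proof.
case: hopt => theta [lambda [sm [sp opt]]].
have [feas min_theta _] := opt.
have le1 : theta <= 1 by apply: min_theta (feasible_one X Y o).
have val : bcc_optimal_value X Y o theta by exists lambda, sm, sp.
(* Two optimal values bound each other from above. Uniqueness turns the existential in both
   efficiency notions into a statement about this [theta]. *)
have val_eq theta' : bcc_optimal_value X Y o theta' -> theta' = theta.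
  move=> [l' [sm' [sp' [feas' min' _]]]]; apply/eqP; rewrite eq_le.
  by rewrite (min' _ _ _ _ feas) (min_theta _ _ _ _ feas').
(* This settles both parts: as [theta <= 1], the case [theta = 1] is exactly the failure of
   [theta < 1]. *)
have dom_iff : theta < 1 <->
    exists x y, T_DEA X Y x y /\ fgl_dominates_I x y (col o X) (col o Y).
  split=> [lt1|[x [y [hT hdom]]]].
    exists (X *m lambda), (Y *m lambda).
    exact: feasible_dominated feas lt1.
  have [theta' [l' [lt1 feas']]] := dominated_feasible hT hdom.
  exact: le_lt_trans (min_theta _ _ _ _ feas') lt1.
split; split.
- by case=> theta' [/val_eq-> /dom_iff].
- by move/dom_iff => lt1; exists theta.
- by case=> theta' [/val_eq-> th1] /dom_iff; rewrite th1 ltxx.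
- move=> ndom; exists theta; split=> //; apply/eqP; rewrite eq_le le1 leNgt.
  by apply/negP => /dom_iff.
Qed.
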